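(* For every integer $n\ge 2$ there exist a positive integer $N$ and, with $m=0$ and $M=2$, a matrix $(A_{ij}(x))_{1\le i\le N,1\le j\le M}$ of semialgebraic functions on $\mathbb{R}^n$ such that there do NOT exist an integer $\mu_{\max}\ge 1$, finitely many linear partial differential operators $L_{\mu,\nu}$ ($1\le\mu\le\mu_{\max}$, $1\le\nu\le\nu_\mu$) and $L'_{\mu,\nu}$ ($1\le\mu\le\mu_{\max}$, $1\le\nu\le\nu'_\mu$) with both of the following properties: (1) Each operator acts on vectors $f=(f_1,\dots,f_N)\in C^\infty(\mathbb{R}^n,\mathbb{R}^N)$ and has the form $$L_{\mu,\nu}f(x)=\sum_{i=1}^N\sum_{|\alpha|\le\bar m}a_{\mu\nu i\alpha}(x)\,\partial^\alpha f_i(x),\qquad L'_{\mu,\nu}f(x)=\sum_{i=1}^N\sum_{|\alpha|\le\bar m}a'_{\mu\nu i\alpha}(x)\,\partial^\alpha f_i(x),$$ where the coefficients $a_{\mu\nu i\alpha},a'_{\mu\nu i\alpha}$ are semialgebraic functions on $\mathbb{R}^n$ and $\bar m\ge m$ is an integer. (2) For every $f=(f_1,\dots,f_N)\in C^\infty(\mathbb{R}^n,\mathbb{R}^N)$, the system $$\sum_{j=1}^M A_{ij}(x)F_j(x)\le f_i(x)\quad(i=1,\dots,N)\ \text{ on }\mathbb{R}^n$$ admits a solution $F=(F_1,\dots,F_M)\in C^m(\mathbb{R}^n,\mathbb{R}^M)$ if and only if there exists $1\le\mu\le\mu_{\max}$ such that $L_{\mu,\nu}f\ge 0$ on $\mathbb{R}^n$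 for each $1\le\nu\le\nu_\mu$ and $L'_{\mu,\nu}f>0$ on $\mathbb{R}^n$ for each $1\le\nu\le\nu'_\mu$.
   Context: A function $\mathbb{R}^n\to\mathbb{R}$ is semialgebraic if its graph can be represented as the solution set of finitely many polynomial equations and/or inequalities (semialgebraic functions need not be continuous). $C^m(\mathbb{R}^n,\mathbb{R}^D)$ denotes the space of $m$-times continuously differentiable $\mathbb{R}^D$-valued functions on $\mathbb{R}^n$, with no growth conditions at infinity; $C^0$ means continuous. *)

(* Defs.v *)
From HB Require Import structures.
From mathcomp Require Import all_boot all_order all_algebra.
From mathcomp Require Import all_classical all_reals all_analysis.
(* The notations of mpoly clash with those of MathComp-Analysis. *)
From mathcomp Require mpoly.
Import (canonicals, coercions) mpoly.

Set Implicit Arguments.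
Unset Strict Implicit.
Unset Printing Implicit Defensive.

Import Order.TTheory GRing.Theory Num.Theory numFieldNormedType.Exports.
Local Open Scope classical_set_scope.
Local Open Scope ring_scope.

(* The solution set of a finite system of polynomial equations and strict
   inequalities, where systems are combined by "and" and "or", written in
   disjunctive normal form: each pair [c] in [s] stands for the conjunction of
   [p = 0] for [p] in [c.1] and [q > 0] for [q] in [c.2]. *)
Definition semialgebraic_set (R : realType) (k : nat) (S : set 'rV[R]_k) : Prop :=
  exists s : seq (seq (mpoly.mpoly k R) * seq (mpoly.mpoly k R)),
    S = [set z : 'rV[R]_k |
      has (fun c => all (fun p => mpoly.meval (z 0) p == 0) c.1 &&
                    all (fun q => 0 < mpoly.meval (z 0) q) c.2) s].

Definition semialgebraic_fun (R : realType) (n : nat) (g : 'rV[R]_n -> R) : Prop :=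
  semialgebraic_set
    [set z : 'rV[R]_(n + 1) | exists x : 'rV[R]_n, z = row_mx x (g x)%:M].

Definition partial_deriv (R : realType) (n : nat) (i : 'I_n)
    (g : 'rV[R]_n -> R) : 'rV[R]_n -> R :=
  fun x => 'D_(delta_mx 0 i) g x.

(* The order in which the variables are differentiated is immaterial for the
   smooth functions to which this is applied. *)
Definition multi_deriv (R : realType) (n : nat) (al : mpoly.multinom n)
    (g : 'rV[R]_n -> R) : 'rV[R]_n -> R :=
  foldr (fun i h => iter (al i) (partial_deriv i) h) g (enum 'I_n).

Fixpoint Ck_scalar (R : realType) (n k : nat) (g : 'rV[R]_n -> R) : Prop :=
  if k is k'.+1 then
    continuous g /\
    forall i : 'I_n, (forall x, derivable g x (delta_mx 0 i)) /\
                     Ck_scalar k' (partial_deriv i g)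
  else continuous g.

Definition Ck (R : realType) (n D k : nat) (F : 'rV[R]_n -> 'rV[R]_D) : Prop :=
  forall j : 'I_D, Ck_scalar k (fun x => F x 0 j).

Definition Cinfty (R : realType) (n D : nat) (F : 'rV[R]_n -> 'rV[R]_D) : Prop :=
  forall k : nat, Ck k F.

(* Coefficients a_{i alpha}(x) of an operator of order at most mbar acting on
   N-vectors; [mpoly.bmultinom n mbar.+1] is the finite type of multi-indices
   alpha in n variables with |alpha| < mbar.+1. *)
Definition diffop_coef (R : realType) (n N mbar : nat) : Type :=
  'I_N -> mpoly.bmultinom n mbar.+1 -> 'rV[R]_n -> R.

Definition diffop (R : realType) (n N mbar : nat) (a : diffop_coef R n N mbar)
    (f : 'rV[R]_n -> 'rV[R]_N) (x : 'rV[R]_n) : R :=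
  \sum_(i < N) \sum_(al : mpoly.bmultinom n mbar.+1)
    a i al x * multi_deriv (mpoly.bmnm al) (fun y => f y 0 i) x.

Definition semialgebraic_diffop (R : realType) (n N mbar : nat)
    (a : diffop_coef R n N mbar) : Prop :=
  forall (i : 'I_N) (al : mpoly.bmultinom n mbar.+1), semialgebraic_fun (a i al).

Definition solvable_ineqs (R : realType) (n N M m : nat)
    (A : 'rV[R]_n -> 'M[R]_(N, M)) (f : 'rV[R]_n -> 'rV[R]_N) : Prop :=
  exists F : 'rV[R]_n -> 'rV[R]_M,
    Ck m F /\
    forall (x : 'rV[R]_n) (i : 'I_N), \sum_(j < M) A x i j * F x 0 j <= f x 0 i.

(* Main.v *)
Require Import Defs.
From mathcomp Require Import all_boot all_order all_algebra.
From mathcomp Require Import all_classical all_reals all_analysis.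
From mathcomp Require Import ring lra.
From mathcomp Require mpoly.
Import (canonicals, coercions) mpoly.
Import Order.TTheory GRing.Theory Num.Theory numFieldNormedType.Exports.
Local Open Scope ring_scope.

Set Implicit Arguments.
Unset Strict Implicit.
Unset Printing Implicit Defensive.

(* The rows of the system depend only on [t = x_1 ^ 2 / |x| ^ 2], so that near the
   origin each of them constrains the value [F 0] of a continuous solution along
   every direction. Away from the origin the rows at a given point lie in a
   common open half-plane and impose nothing, so solvability is a condition on
   [f 0] alone, and the admissible [f 0] form a convex cone whose boundary
   contains an arc of a parabola.

   Suppose operators as in the statement exist. An alternative [mu] whose
   operators are nontrivial at infinitely many points can be violated by
   perturbing [f] near one of these points, and this can be done for all such
   [mu] at once, at distinct points, without changing [f 0]. The remaining
   alternatives involve finitely many linear functionals of [f], so they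
   describe a finite union of polyhedra, which cannot contain infinitely many
   points of the parabola without leaving the cone. *)

(** * Smooth functions and iterated partial derivatives *)

Section SmoothFunctions.
Variables (R : realType) (n : nat).
Implicit Types (f g h s : 'rV[R]_n -> R) (x y : 'rV[R]_n) (k m : nat)
  (i j : 'I_n) (l : seq 'I_n).

Definition smooth f := forall k, Ck_scalar k f.

Lemma Ck_scalar_continuous k f : Ck_scalar k f -> continuous f.
Proof. by case: k => [|k] // []. Qed.

Lemma Ck_scalarW k f : Ck_scalar k.+1 f -> Ck_scalar k f.
Proof.
elim: k f => [|k IH] f [cf Hf] //=; split=> // i.
by have [df Cf] := Hf i; split=> //; exact: IH.
Qed.

Lemma smooth_derivable f i x : smooth f -> derivable f x (delta_mx 0 i).
Proof. by move=> /(_ 1%N) [_ /(_ i) []]. Qed.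

Lemma smooth_partial f i : smooth f -> smooth (partial_deriv i f).
Proof. by move=> sf k; have [_ /(_ i) []] := sf k.+1. Qed.

Lemma partial_cst c i : partial_deriv i (cst c : 'rV[R]_n -> R) = cst 0.
Proof. by apply/funext => x; rewrite /partial_deriv derive_cst. Qed.

Lemma smooth_cst c : smooth (cst c).
Proof.
move=> k; elim: k c => [|k IH] c /=; first exact: cst_continuous.
split; first exact: cst_continuous.
by move=> i; split=> [x|]; [exact: derivable_cst|rewrite partial_cst].
Qed.

Lemma partialD f g i : smooth f -> smooth g ->
  partial_deriv i (f + g) = partial_deriv i f + partial_deriv i g.
Proof.
move=> sf sg; apply/funext => x; rewrite /partial_deriv deriveD //;
  exact: smooth_derivable.
Qed.

Lemma Ck_scalarD k f g : Ck_scalar k f -> Ck_scalar k g -> Ck_scalar k (f + g).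
Proof.
elim: k f g => [|k IH] f g.
  by move=> cf cg x; exact: (cvgD (cf x) (cg x)).
move=> [cf Hf] [cg Hg]; split=> [x|i]; first exact: (cvgD (cf x) (cg x)).
have [df Cf] := Hf i; have [dg Cg] := Hg i.
split=> [x|]; first exact: derivableD.
suff -> : partial_deriv i (f + g) = partial_deriv i f + partial_deriv i g.
  exact: IH.
by apply/funext => x; rewrite /partial_deriv deriveD.
Qed.

Lemma Ck_scalarM k f g : Ck_scalar k f -> Ck_scalar k g -> Ck_scalar k (f * g).
Proof.
elim: k f g => [|k IH] f g.
  by move=> cf cg x; exact: (cvgM (cf x) (cg x)).
move=> Hf' Hg'; have [cf Hf] := Hf'; have [cg Hg] := Hg'.
split=> [x|i]; first exact: (cvgM (cf x) (cg x)).
have [df Cf] := Hf i; have [dg Cg] := Hg i.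
split=> [x|]; first exact: derivableM.
suff -> : partial_deriv i (f * g) = f * partial_deriv i g + g * partial_deriv i f.
  by apply: Ck_scalarD; apply: IH => //; exact: Ck_scalarW.
by apply/funext => x; rewrite /partial_deriv deriveM.
Qed.

Lemma partialM f g i : smooth f -> smooth g ->
  partial_deriv i (f * g) = f * partial_deriv i g + g * partial_deriv i f.
Proof.
move=> sf sg; apply/funext => x; rewrite /partial_deriv deriveM //;
  exact: smooth_derivable.
Qed.

Lemma smoothD f g : smooth f -> smooth g -> smooth (f + g).
Proof. by move=> sf sg k; exact: Ck_scalarD. Qed.

Lemma smoothM f g : smooth f -> smooth g -> smooth (f * g).
Proof. by move=> sf sg k; exact: Ck_scalarM. Qed.

Lemma smoothX f k : smooth f -> smooth (f ^+ k).
Proof.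
move=> sf; elim: k => [|k IH]; first exact: smooth_cst.
by rewrite exprS; exact: smoothM.
Qed.

Lemma smoothN f : smooth f -> smooth (- f).
Proof. by move=> sf; rewrite -mulN1r; apply: smoothM => //; exact: (smooth_cst (-1)). Qed.

Lemma smoothB f g : smooth f -> smooth g -> smooth (f - g).
Proof. by move=> sf sg; apply: smoothD => //; exact: smoothN. Qed.

Lemma smooth_coord i : smooth (fun x => x 0 i).
Proof.
case=> [|k]; first exact: coord_continuous.
split=> [|j]; first exact: coord_continuous.
split=> [x|]; first exact/diff_derivable/differentiable_coord.
suff -> : partial_deriv j (fun x => x 0 i) = cst ((j == i)%:R).
  exact: smooth_cst.
apply/funext => x; apply: cvg_lim => //.
apply: (@cvg_trans _ (cst ((j == i)%:R : R) @ (0:R)^')%classic); last exact: cvg_cst.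
apply: near_eq_cvg; near=> e.
have e0 : e != 0 by near: e; exact: nbhs_dnbhs_neq.
by rewrite /= !mxE eqxx addrK eq_sym [RHS]mulKf.
Unshelve. all: by end_near. Qed.

Definition partials l f := foldr (@partial_deriv R n) f l.

Lemma smooth_partials l f : smooth f -> smooth (partials l f).
Proof. by elim: l => //= i l IH /IH; exact: smooth_partial. Qed.

Lemma partialsD l f g : smooth f -> smooth g ->
  partials l (f + g) = partials l f + partials l g.
Proof.
move=> sf sg; elim: l => //= i l ->.
by rewrite partialD //; exact: smooth_partials.
Qed.

Lemma partialsZ l c f : smooth f -> partials l (cst c * f) = cst c * partials l f.
Proof.
move=> sf; elim: l => //= i l ->.
rewrite partialM ?partial_cst; [|exact: smooth_cst|exact: smooth_partials].
by apply/funext => x; rewrite !fctE mulr0 addr0.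
Qed.

(** One differentiation costs at most one power of [h]. *)
Lemma partial_expM h s k i : smooth h -> smooth s ->
  exists2 t, smooth t & partial_deriv i (h ^+ k.+1 * s) = h ^+ k * t.
Proof.
move=> sh ss; elim: k => [|k [t st Ht]].
  exists (partial_deriv i (h * s)); last by rewrite expr1 expr0 mul1r.
  exact/smooth_partial/smoothM.
exists (t + s * partial_deriv i h).
  by apply: smoothD => //; apply: smoothM => //; exact: smooth_partial.
rewrite exprS -mulrA partialM ?Ht//; last by apply: smoothM => //; exact: smoothX.
by rewrite mulrA -exprS mulrDr mulrA.
Qed.

Lemma partials_expM_eq0 l h s m x : smooth h -> smooth s -> h x = 0 ->
  (size l < m)%N -> partials l (h ^+ m * s) x = 0.
Proof.
move=> sh ss hx lm.
suff [t st ->] : exists2 t, smooth t & partials l (h ^+ m * s) = h ^+ (m - size l) * t.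
  by rewrite -(subnSK lm) exprS !fctE hx !mul0r.
elim: l lm => [|i l IH] lm /=; first by exists s; rewrite ?subn0.
have [t st ->] := IH (ltnW lm).
have [r sr Hr] := @partial_expM h t (m - size l).-1 i sh st.
by exists r; rewrite // subnS -Hr prednK // subn_gt0 ltnW.
Qed.

(** Replaces a multi-index by a list of directions, on which induction is available. *)
Lemma multi_derivE (al : mpoly.multinom n) :
  exists2 l, size l = mpoly.mdeg al &
    forall f, multi_deriv al f = partials l f.
Proof.
exists (flatten [seq nseq (al i) i | i <- enum 'I_n]).
  rewrite size_flatten /shape -map_comp sumnE big_map mpoly.mdegE -big_enum /=.
  by apply: eq_bigr => i _; rewrite size_nseq.
move=> f; rewrite /multi_deriv; elim: (enum _) => //= i s ->.
by rewrite /partials foldr_cat; elim: (al i) => //= k ->.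
Qed.

End SmoothFunctions.

(** * Cutoffs that are flat to finite order at finitely many points *)

Section Cutoffs.
Variables (R : realType) (n : nat).
Implicit Types (h s u v chi : 'rV[R]_n -> R) (x y : 'rV[R]_n).

(** Divisibility by [h ^+ m] is an algebraic substitute for the vanishing at [x] of all derivatives
    of order below [m]. *)
Definition flat_at m x v :=
  exists h s, [/\ smooth h, smooth s, h x = 0 & v = h ^+ m * s].

(** As in Lagrange interpolation, [u] is a product of affine functions, each using a coordinate in
    which [x] and [y] differ. *)
Lemma smooth_separating x (ys : seq 'rV[R]_n) : x \notin ys ->
  exists u, [/\ smooth u, u x = 1 & {in ys, forall y, u y = 0}].
Proof.
elim: ys => [|y ys IH]; first by exists (cst 1); split=> //; exact: smooth_cst.
rewrite inE negb_or => /andP[xy /IH [u [su ux uys]]].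
have [i xyi] : exists i, x 0 i != y 0 i.
  apply/existsP; rewrite -negb_forall; apply: contra xy => /forallP xy.
  by apply/eqP/rowP => i; exact/eqP.
pose v := cst (x 0 i - y 0 i)^-1 * ((fun z : 'rV[R]_n => z 0 i) - cst (y 0 i)).
exists (v * u); split.
- apply: smoothM => //; apply: smoothM; first exact: smooth_cst.
  by apply: smoothB; [exact: smooth_coord|exact: smooth_cst].
- by rewrite /v !fctE ux mulr1 mulVf // subr_eq0.
- move=> z; rewrite inE => /orP[/eqP ->|/uys uz]; rewrite /v !fctE.
    by rewrite subrr mulr0 mul0r.
  by rewrite uz mulr0.
Qed.

(** Only finitely many points matter, so a polynomial in [u] serves as bump function:
    [1 - (1 - u ^+ m) ^+ m] is a multiple of [u ^+ m], and [1 - u ^+ m] vanishes at [x]. *)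
Lemma smooth_cutoff m x (ys : seq 'rV[R]_n) : x \notin ys ->
  exists chi, [/\ smooth chi, flat_at m x (chi - 1) &
                  {in ys, forall y, flat_at m y chi}].
Proof.
move=> /smooth_separating [u [su ux uys]].
have s1 : smooth (1 : 'rV[R]_n -> R) by exact: smooth_cst.
have s0 : smooth (0 : 'rV[R]_n -> R) by exact: smooth_cst.
have suX k : smooth (1 - u ^+ k) by apply: smoothB => //; exact: smoothX.
exists (1 - (1 - u ^+ m) ^+ m); split.
- by apply: smoothB => //; exact: smoothX.
- exists (1 - u ^+ m), (- 1); split=> //; first exact: smoothN.
    by rewrite -[LHS]/(1 - (u ^+ m) x) fctE ux expr1n subrr.
  by rewrite addrC addKr mulrN1.
- move=> y /uys uy.
  suff [s ss ->] : exists2 s, smooth s & 1 - (1 - u ^+ m) ^+ m = u ^+ m * s.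
    by exists u, s.
  elim: {2}m => [|k [s ss Hs]].
    by exists 0; rewrite // expr0 subrr mulr0.
  exists (s + (1 - u ^+ m) ^+ k).
    by apply: smoothD => //; exact: smoothX.
  by rewrite mulrDr -Hs exprS; ring.
Qed.

End Cutoffs.

(** * Linearity and locality of differential operators *)

Section DifferentialOperators.
Variables (R : realType) (n N mbar : nat).
Implicit Types (a : diffop_coef R n N mbar) (f g : 'rV[R]_n -> 'rV[R]_N)
  (x : 'rV[R]_n) (chi : 'rV[R]_n -> R).

Lemma CinftyP f : Cinfty f <-> forall i, smooth (fun x => f x 0 i).
Proof. by split=> [Cf i k|Cf k i]; exact: Cf. Qed.

Lemma Cinfty_lin f g c : Cinfty f -> Cinfty g -> Cinfty (fun x => f x + c *: g x).
Proof.
move=> /CinftyP Cf /CinftyP Cg; apply/CinftyP => i.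
rewrite (_ : (fun x => _) = (fun x => f x 0 i) + cst c * (fun x => g x 0 i)).
  by apply: smoothD => //; apply: smoothM => //; exact: smooth_cst.
by apply/funext => x; rewrite !fctE !mxE.
Qed.

Lemma Cinfty_mul chi f : smooth chi -> Cinfty f -> Cinfty (fun x => chi x *: f x).
Proof.
move=> schi /CinftyP Cf; apply/CinftyP => i.
rewrite (_ : (fun x => _) = chi * (fun x => f x 0 i)); first exact: smoothM.
by apply/funext => x; rewrite !fctE !mxE.
Qed.

Lemma diffop_lin a f g c x : Cinfty f -> Cinfty g ->
  diffop a (fun y => f y + c *: g y) x = diffop a f x + c * diffop a g x.
Proof.
move=> /CinftyP Cf /CinftyP Cg; rewrite /diffop mulr_sumr -big_split /=.
apply: eq_bigr => i _; rewrite mulr_sumr -big_split /=.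
apply: eq_bigr => al _; have [l _ E] := multi_derivE R (mpoly.bmnm al).
rewrite !E (_ : (fun y => _) = (fun y => f y 0 i) + cst c * (fun y => g y 0 i)).
  rewrite partialsD ?partialsZ //; last by apply: smoothM => //; exact: smooth_cst.
  by rewrite !fctE; ring.
by apply/funext => y; rewrite !fctE !mxE.
Qed.

(** At most [mbar] differentiations leave at least one factor [h] of [h ^+ mbar.+1]. *)
Lemma diffop_flat a chi f x : flat_at mbar.+1 x chi -> Cinfty f ->
  diffop a (fun y => chi y *: f y) x = 0.
Proof.
move=> [h [s [sh ss hx ->]]] /CinftyP Cf.
rewrite /diffop big1 // => i _; rewrite big1 // => al _.
have [l sl E] := multi_derivE R (mpoly.bmnm al).
rewrite E (_ : (fun y => _) = h ^+ mbar.+1 * (s * (fun y => f y 0 i))).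
  rewrite partials_expM_eq0 ?mulr0 //; first exact: smoothM.
  by rewrite sl mpoly.bmdeg.
by apply/funext => y; rewrite !fctE !mxE mulrA.
Qed.

Lemma diffop_cutoff a chi f x : smooth chi -> flat_at mbar.+1 x (chi - 1) ->
  Cinfty f -> diffop a (fun y => chi y *: f y) x = diffop a f x.
Proof.
move=> schi /(diffop_flat a) H Cf; have /= := H f Cf.
rewrite (_ : (fun y => (_ - _) y *: _) = (fun y => chi y *: f y + (-1) *: f y)).
  rewrite diffop_lin //; last exact: Cinfty_mul.
  by move/eqP; rewrite mulN1r subr_eq0 => /eqP.
by apply/funext => y; rewrite !fctE scaleN1r scalerBl scale1r.
Qed.

Definition diffop_nontrivial a x := exists2 f, Cinfty f & diffop a f x != 0.

(** A function that [a] detects at [x] is cut off and rescaled; flatness of the cutoff hides the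
    result from all operators of order [mbar] at the points of [ys]. *)
Lemma exists_perturbation a (x : 'rV[R]_n) (ys : seq 'rV[R]_n) (c : R) :
  x \notin ys -> diffop_nontrivial a x ->
  exists g, [/\ Cinfty g, diffop a g x = c, {in ys, forall y, g y = 0} &
    forall (b : diffop_coef R n N mbar) y, y \in ys -> diffop b g y = 0].
Proof.
move=> xys [f Cf fx].
have [chi [schi chix chiys]] := smooth_cutoff mbar.+1 xys.
have Cg := Cinfty_mul schi Cf.
pose z : 'rV[R]_n -> 'rV[R]_N := fun=> 0.
have C0 : Cinfty z.
  apply/CinftyP => i; rewrite (_ : (fun x => _) = cst 0); first exact: smooth_cst.
  by apply/funext => y; rewrite mxE.
have op0 (b : diffop_coef R n N mbar) y : diffop b z y = 0.
  have := diffop_lin b (-1) y C0 C0; rewrite mulN1r subrr => <-.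
  by congr (diffop b _ y); apply/funext => y'; rewrite /z scaler0 addr0.
exists (fun y => z y + (c / diffop a f x) *: (chi y *: f y)); split.
- exact: Cinfty_lin.
- by rewrite diffop_lin // op0 add0r diffop_cutoff // divfK.
- move=> y /chiys [h [s [_ _ hy ->]]].
  by rewrite !fctE hy expr0n mul0r scale0r scaler0 /z addr0.
- move=> b y /chiys yflat.
  by rewrite diffop_lin // op0 add0r diffop_flat // mulr0.
Qed.

End DifferentialOperators.

(** * Finite unions of systems of operator inequalities *)

Section FiniteUnions.
Variables (R : realType) (n N mbar : nat).
Variables (I : finType) (J : I -> finType).
Variable op : forall mu, J mu -> diffop_coef R n N mbar.
Variable strict : forall mu, J mu -> bool.
Arguments op {mu}.
Arguments strict {mu}.
Local Notation vfun := ('rV[R]_n -> 'rV[R]_N).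
Implicit Types (f g : vfun) (x y : 'rV[R]_n) (mu : I).

Definition satisfies mu f := forall (c : J mu) x,
  if strict c then 0 < diffop (op c) f x else 0 <= diffop (op c) f x.

(** Infinitude is phrased as escape from every finite list, the form in which fresh points get
    picked. *)
Definition infinite_support mu := forall ys : seq 'rV[R]_n,
  exists2 x, x \notin ys & exists c : J mu, diffop_nontrivial (op c) x.

Lemma common_finite_support : exists ys : seq 'rV[R]_n,
  forall mu, ~ infinite_support mu -> forall (c : J mu) x f,
    x \notin ys -> Cinfty f -> diffop (op c) f x = 0.
Proof.
have /choice[ys_ Hys] : forall mu, exists ys : seq 'rV[R]_n,
    ~ infinite_support mu -> forall (c : J mu) x f,
    x \notin ys -> Cinfty f -> diffop (op c) f x = 0.
  move=> mu; have [inf|] := pselect (infinite_support mu).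
    by exists [::] => /(_ inf).
  move=> /existsNP [ys Hys]; exists ys => _ c x f xys Cf.
  apply/eqP; apply: contrapT => /negP fx; apply: Hys.
  by exists x => //; exists c, f.
exists (flatten [seq ys_ mu | mu <- enum I]) => mu fin c x f xys.
apply: (Hys mu) => //; apply: contra xys => xys.
by apply/flatten_mapP; exists mu; rewrite ?mem_enum.
Qed.

Lemma violating_perturbation (p : nat -> vfun) (K : nat) :
  (forall k, Cinfty (p k)) ->
  exists g, [/\ Cinfty g, g 0 = 0 & forall mu, infinite_support mu ->
    forall k, (k < K)%N -> ~ satisfies mu (fun x => p k x + 1 *: g x)].
Proof.
move=> Cp.
(* The induction records the witness points [zs]: later perturbations are invisible to all operators
   there, so earlier violations persist. *)
suff [g [zs [Cg g0 Hg]]] : exists g (zs : seq 'rV[R]_n), [/\ Cinfty g, g 0 = 0 &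
    forall mu, mu \in enum I -> infinite_support mu ->
    exists2 x, x \in zs & exists c : J mu,
    forall k, (k < K)%N -> diffop (op c) (fun x => p k x + 1 *: g x) x < 0].
  exists g; split=> // mu inf k kK sat.
  have [|x _ [c /(_ k kK) neg]] := Hg mu _ inf; first by rewrite mem_enum.
  have := sat c x; case: ifP => _.
    by rewrite lt_gtF.
  by rewrite leNgt neg.
elim: (enum I) => [|mu s [g [zs [Cg g0 IH]]]].
  exists (fun=> 0), [::]; split=> //; apply/CinftyP => i k.
  rewrite (_ : (fun x => _) = cst 0); first exact: smooth_cst.
  by apply/funext => y; rewrite mxE.
have [inf|fin] := pselect (infinite_support mu); last first.
  exists g, zs; split=> // mu'; rewrite inE => /orP[/eqP ->//|]; exact: IH.
(* Avoiding the origin as well lets the new perturbation vanish there. *)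
have [x xzs [c nontriv]] := inf (0 :: zs).
pose v k := diffop (op c) (fun x => p k x + 1 *: g x) x.
(* Adding this prescribed value brings every [v k] with [k < K] down to at most -1
   simultaneously. *)
have [g' [Cg' g'x g'0 g'zs]] :=
  exists_perturbation (- 1 - \sum_(k < K) `|v k|) xzs nontriv.
have opE mu' (c' : J mu') k y : diffop (op c') (fun x => p k x + 1 *: (g x + 1 *: g' x)) y
    = diffop (op c') (fun x => p k x + 1 *: g x) y + diffop (op c') g' y.
  rewrite !diffop_lin //; last exact: Cinfty_lin.
  by rewrite !mul1r addrA.
exists (fun x => g x + 1 *: g' x), (x :: zs); split.
- exact: Cinfty_lin.
- by rewrite g0 g'0 ?mem_head // scaler0 addr0.
- move=> mu'; rewrite inE; have [-> _ _|_ /= mu's] := eqVneq mu' mu.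
    exists x; first exact: mem_head.
    exists c => k kK; rewrite opE g'x -/(v k).
    rewrite (bigD1 (Ordinal kK)) //=; have := ler_norm (v k).
    have : 0 <= \sum_(i < K | i != Ordinal kK) `|v i| by apply: sumr_ge0.
    lra.
  move=> /(IH _ mu's) [y yzs [c' Hc']].
  exists y; first by rewrite inE yzs orbT.
  exists c' => k kK; rewrite opE g'zs ?addr0 ?Hc' //.
  by rewrite inE yzs orbT.
Qed.

(** The step is the inverse of a number exceeding all the ratios [|w t / u t|]; indices with
    [u t = 0] contribute 0 to the sum. *)
Lemma exists_small_step (T : finType) (u w : T -> R) :
  exists2 e, 0 < e & forall t, 0 < u t -> 0 < u t + e * w t.
Proof.
pose d := 1 + \sum_t `|w t / u t|.
have d0 : 0 < d by rewrite ltr_pwDl // sumr_ge0.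
exists d^-1; first by rewrite invr_gt0.
move=> t ut0; have : `|w t / u t| < d.
  rewrite /d (bigD1 t) //=.
  have : 0 <= \sum_(i | i != t) `|w i / u i| by apply: sumr_ge0.
  lra.
rewrite normrM normfV (gtr0_norm ut0) ltr_pdivrMr // mulrC => wt.
rewrite -[X in X + _](mulKf (lt0r_neq0 d0)) -mulrDr pmulr_rgt0 ?invr_gt0 //.
by have := ler_norm (- w t); rewrite normrN mulrC; lra.
Qed.

(* Alternatives of infinite support are all violated by a suitable [g].  The
   other ones involve finitely many linear functionals altogether, so by the
   pigeonhole principle two of the data [q k] and [q l] satisfy the same
   alternative with the same active constraints, and the segment from [q l] to
   [q k] can be prolonged beyond [q k] inside that alternative. *)
Lemma union_of_constraints_extends (p : nat -> vfun) :
  (forall k, Cinfty (p k)) ->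
  (forall g, Cinfty g -> g 0 = 0 -> forall k,
    exists mu, satisfies mu (fun x => p k x + 1 *: g x)) ->
  exists g k l e, let q j := fun x => p j x + 1 *: g x in
    [/\ Cinfty g, g 0 = 0, k <> l, 0 < e &
     exists mu, satisfies mu (fun x => q k x + e *: (q k x + (-1) *: q l x))].
Proof.
move=> Cp Hp; have [ys Hys] := common_finite_support.
pose tag_ := {mu : I & ('I_(size ys) * J mu)%type}.
(* One more than the number of pairs of an alternative and a set of active constraints. *)
pose K := #|{: I * {set tag_}}|.+1.
have [g [Cg g0 Hg]] := @violating_perturbation p K Cp.
pose q j := fun x => p j x + 1 *: g x.
have Cq j : Cinfty (q j) by exact: Cinfty_lin.
have {Hg}Hg : forall mu, infinite_support mu ->
  forall k, (k < K)%N -> ~ satisfies mu (q k) by [].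
have {Hp}/choice[mu_ sat] : forall k, exists mu, satisfies mu (q k) by exact: Hp.
suff [k [l [e [kl e0 sate]]]] : exists (k l : nat) (e : R), [/\ k <> l, 0 < e &
    exists mu, satisfies mu (fun x => q k x + e *: (q k x + (-1) *: q l x))].
  by exists g, k, l, e.
move: q Cq Hg sat => q Cq Hg sat.
pose val_ (t : tag_) f := diffop (op (tagged t).2) f (nth 0 ys (tagged t).1).
pose sig (k : 'I_K) := (mu_ k, [set t : tag_ | val_ t (q k) == 0]).
have /injectivePn [k [l kl [mukl act]]] : ~~ injectiveb sig.
  by apply/negP => /injectiveP /leq_card; rewrite card_ord ltnn.
have [e e0 He] := exists_small_step (val_ ^~ (q k))
  (fun t => val_ t (fun x => q k x + (-1) *: q l x)).
exists k, l, e; split=> //; first by move/val_inj => E; rewrite E eqxx in kl.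
exists (mu_ k) => c x.
have fin : ~ infinite_support (mu_ k).
  by move=> /Hg /(_ k (ltn_ord k)); exact.
have satk := sat k c x; rewrite diffop_lin //; last exact: Cinfty_lin.
move: satk.
(* Outside [ys] the operators of this alternative vanish on all smooth data, so the condition at [x]
   is the one met by [q k]. *)
have [xys|xys] := boolP (x \in ys); last first.
  by rewrite !(Hys _ fin) // ?mulr0 ?addr0 //; exact: Cinfty_lin.
have ix : (index x ys < size ys)%N by rewrite index_mem.
pose t : tag_ := existT _ (mu_ k) (Ordinal ix, c).
have vE f : val_ t f = diffop (op c) f x by rewrite /val_ /= nth_index.
(* A constraint active at [q k] is also active at [q l], hence zero along the whole line; an
   inactive one is positive at [q k] and survives the small step. *)
rewrite -!vE; have [qk0|qk0] := eqVneq (val_ t (q k)) 0.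
  have /setP/(_ t) := act; rewrite !inE qk0 eqxx => /esym /eqP ql0.
  have -> : val_ t (fun x => q k x + (-1) *: q l x) = 0.
    by rewrite vE diffop_lin // -!vE qk0 ql0 mulr0 addr0.
  by rewrite mulr0 addr0.
have step := He t.
by case: (strict c) => [/step|] //; rewrite le_eqVlt eq_sym (negPf qk0) => /step/ltW.
Qed.

End FiniteUnions.

(** * The squared direction cosine and its semialgebraicity *)

Section DirectionCosine.
Variables (R : realType) (n : nat).
Implicit Types (x : 'rV[R]_n) (i : 'I_n) (q : {poly R}).

Definition sqnorm x : R := \sum_i x 0 i ^+ 2.

(* Takes the junk value [0 / 0 = 0] at the origin. *)
Definition cos2 i x : R := x 0 i ^+ 2 / sqnorm x.

Lemma sqnorm_ge0 x : 0 <= sqnorm x.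
Proof. by apply: sumr_ge0 => i _; exact: sqr_ge0. Qed.

Lemma sqnorm_eq0 x : (sqnorm x == 0) = (x == 0).
Proof.
rewrite psumr_eq0; last by move=> i _; exact: sqr_ge0.
apply/allP/eqP => [H|-> i _]; last by rewrite /= mxE expr0n eqxx.
apply/rowP => i; have := H i (mem_index_enum _).
by rewrite /= sqrf_eq0 mxE => /eqP.
Qed.

Lemma cos2_ge0 i x : 0 <= cos2 i x.
Proof. by rewrite divr_ge0 ?sqr_ge0 // sqnorm_ge0. Qed.

Lemma cos2_le1 i x : cos2 i x <= 1.
Proof.
have [x0|x0] := eqVneq (sqnorm x) 0; first by rewrite /cos2 x0 invr0 mulr0.
rewrite ler_pdivrMr ?lt_def ?x0 ?sqnorm_ge0 // mul1r /sqnorm (bigD1 i) //=.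
by rewrite lerDl sumr_ge0 // => j _; exact: sqr_ge0.
Qed.

Lemma cos20 i : cos2 i 0 = 0.
Proof. by rewrite /cos2 mxE expr0n mul0r. Qed.

Lemma cos2Z i (e : R) x : e != 0 -> cos2 i (e *: x) = cos2 i x.
Proof.
move=> e0; rewrite /cos2 mxE exprMn.
suff -> : sqnorm (e *: x) = e ^+ 2 * sqnorm x by rewrite -mulf_div divff ?mul1r ?expf_neq0.
by rewrite /sqnorm mulr_sumr; apply: eq_bigr => j _; rewrite mxE exprMn.
Qed.

Lemma cos2_surj i j (a : R) : i != j -> 0 <= a <= 1 -> exists x, cos2 i x = a.
Proof.
move=> ij /andP[a0 a1].
exists (\row_k (if k == i then Num.sqrt a else if k == j then Num.sqrt (1 - a) else 0)).
rewrite /cos2 /sqnorm mxE eqxx (bigD1 i) //= (bigD1 j) 1?eq_sym //= !mxE eqxx.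
rewrite eq_sym (negPf ij) eqxx !sqr_sqrtr ?subr_ge0 //.
rewrite big1 => [|k /andP[/negPf ki /negPf kj]]; last by rewrite mxE ki kj expr0n.
by rewrite addr0 addrC subrK divr1.
Qed.

Lemma cos2_continuous i x : x != 0 -> {for x, continuous (cos2 i)}.
Proof.
move=> x0.
have c2 j : (((y : 'rV[R]_n) 0 j ^+ 2) @[y --> x] --> x 0 j ^+ 2)%classic.
  exact: (cvgM (@coord_continuous _ _ _ 0 j x) (@coord_continuous _ _ _ 0 j x)).
have cs : (sqnorm y @[y --> x] --> sqnorm x)%classic.
  by apply: (cvg_big add_continuous) => [|j _]; [exact: nbhs_filter|exact: c2].
have s0 : sqnorm x != 0 by rewrite sqnorm_eq0.
exact: (cvgM (c2 i) (cvgV s0 cs)).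
Qed.

(** Clearing denominators in [q] turns the graph into [Z * Q ^+ d = P] where [Q > 0]; at the origin
    the junk value of [cos2] gives [q.[0]]. *)
Lemma semialgebraic_poly_cos2 i q : semialgebraic_fun (fun x => q.[cos2 i x]).
Proof.
pose Xs (j : 'I_n) := mpoly.mpolyX R (mpoly.mnm1 (lshift 1 j)).
pose Z := mpoly.mpolyX R (mpoly.mnm1 (rshift n (0 : 'I_1))).
pose Q := \sum_j Xs j ^+ 2; pose d := size q.
pose P := \sum_(k < d) q`_k *: (Xs i ^+ 2) ^+ k * Q ^+ (d - k).
exists [:: ([:: Q; Z - mpoly.mpolyC _ q.[0]], [::]); ([:: Z * Q ^+ d - P], [:: Q])].
apply/funext => z; apply/propext.
pose x := lsubmx z; pose w := z 0 (rshift n (0 : 'I_1)).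
have zE : z = row_mx x w%:M.
  by rewrite -[LHS]hsubmxK; congr row_mx; apply/rowP => j; rewrite !ord1 !mxE.
have mevalXn (p : mpoly.mpoly (n + 1) R) k :
    mpoly.meval (z 0) (p ^+ k) = mpoly.meval (z 0) p ^+ k.
  by elim: k => [|k IH]; rewrite ?mpoly.meval1 // !exprS mpoly.mevalM IH.
have XsE j : mpoly.meval (z 0) (Xs j) = x 0 j by rewrite mpoly.mevalXU mxE.
have QE : mpoly.meval (z 0) Q = sqnorm x.
  by rewrite raddf_sum; apply: eq_bigr => j _; rewrite /= mevalXn XsE.
have PE : sqnorm x != 0 -> mpoly.meval (z 0) P = sqnorm x ^+ d * q.[cos2 i x].
  move=> x0; rewrite raddf_sum horner_coef mulr_sumr; apply: eq_bigr => k _ /=.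
  rewrite mpoly.mevalM mpoly.mevalZ !mevalXn XsE QE /cos2 expr_div_n.
  rewrite -[X in _ = _ ^+ X * _](subnK (ltnW (ltn_ord k))) exprD.
  have : sqnorm x ^+ k != 0 by rewrite expf_neq0.
  by move=> ?; field.
transitivity (w = q.[cos2 i x]).
  split=> [[y zy]|wq]; last by exists x; rewrite -wq.
  by move: zE; rewrite {1}zy => /eq_row_mx [<- /matrixP/(_ 0 0)]; rewrite !mxE.
rewrite /= !andbT orbF !mpoly.mevalB mpoly.mevalC mpoly.mevalM mevalXn QE.
rewrite /Z mpoly.mevalXU -/w; have [x0|x0] := eqVneq (sqnorm x) 0.
  rewrite x0 ltxx andbF orbF /= subr_eq0 /cos2 x0 invr0 mulr0.
  by split=> [->|/eqP].
rewrite PE //= lt_def x0 sqnorm_ge0 andbT subr_eq0 mulrC.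
rewrite (inj_eq (mulfI _)) ?expf_neq0 // andbT.
by split=> [->|/eqP].
Qed.

End DirectionCosine.

(** * The three-row system and its parabola of boundary data *)

Section ParabolaSystem.
Variables (R : realType) (n : nat) (i1 : 'I_n).
Implicit Types (f : 'rV[R]_n -> 'rV[R]_3) (x : 'rV[R]_n) (a t : R).

(** At [t = 0] the last two rows bound the components of [F 0] from below. A constant last row
    [(0, -1)] would fail: at [t = 1] the rows [(1, 1)], [(-1, 0)], [(0, -1)] lie in no common open
    half-plane. *)
Definition parabola_row (i : 'I_3) (j : 'I_2) : {poly R} :=
  nth 0 (nth [::] [:: [:: 'X *+ 2 - 1; 2%:P - 'X^2]; [:: -1; 0]; [:: - ('X *+ 2); 'X - 1]] i) j.

Definition parabola_system x : 'M[R]_(3, 2) :=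
  \matrix_(i, j) (parabola_row i j).[cos2 i1 x].

(* For [F 0 = (a, 1)] with [1 / 2 <= a <= 1], the supremum over [t] in [[0, 1]]
   of the first row [(2 t - 1) a + (2 - t ^ 2)] is attained at [t = a], where
   it is [a ^ 2 - a + 2]; hence these points are on the boundary of the set of
   values at the origin of the admissible right-hand sides. *)
Definition parabola_point a : 'rV[R]_3 := \row_i [:: a ^+ 2 - a + 2; - a; -1]`_i.

Lemma parabola_systemP x (v : 'rV[R]_2) (b : 'rV[R]_3) (t := cos2 i1 x) :
  (forall i, \sum_j parabola_system x i j * v 0 j <= b 0 i) <->
  [/\ (t *+ 2 - 1) * v 0 0 + (2 - t ^+ 2) * v 0 1 <= b 0 0,
      - v 0 0 <= b 0 1 & - (t *+ 2) * v 0 0 + (t - 1) * v 0 1 <= b 0 2].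
Proof.
have E i : \sum_j parabola_system x i j * v 0 j =
    (parabola_row i 0).[t] * v 0 0 + (parabola_row i 1).[t] * v 0 1.
  rewrite !big_ord_recl big_ord0 addr0 !mxE.
  by have -> : lift ord0 ord0 = 1 :> 'I_2 by exact/val_inj.
split=> [H|[H0 H1 H2] i].
  have := H 0; have := H 1; have := H 2; rewrite !E /= !hornerE.
  by split; lra.
rewrite (E i); case: i => [[|[|[|//]]] ilt] /=; rewrite !hornerE /=.
- by rewrite (_ : Ordinal _ = 0); [lra|exact/val_inj].
- by rewrite (_ : Ordinal _ = 1); [lra|exact/val_inj].
- by rewrite (_ : Ordinal _ = 2); [lra|exact/val_inj].
Qed.

(* The direction [(4, 1 - 7 t)] decreases every row of the system at unit
   speed, so moving along it absorbs the variation of [f] near the origin. *)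
Lemma parabola_solvable f a : 1 / 2 <= a -> Cinfty f -> f 0 = parabola_point a ->
  solvable_ineqs 0 parabola_system f.
Proof.
move=> a12 /CinftyP Cf f0.
pose h x : R := \sum_i `|f x 0 i - f 0 0 i|.
pose t x := cos2 i1 x.
have h_ge i x : f 0 0 i - h x <= f x 0 i.
  rewrite /h (bigD1 i) //=.
  have : 0 <= \sum_(j | j != i) `|f x 0 j - f 0 0 j| by apply: sumr_ge0.
  by have := ler_norm (- (f x 0 i - f 0 0 i)); rewrite normrN; lra.
have h0 : h 0 = 0 by rewrite /h big1 // => i _; rewrite subrr normr0.
have hpos x : 0 <= h x by apply: sumr_ge0.
have ch : continuous h.
  move=> x; apply: (cvg_big add_continuous) => [|i _]; first exact: nbhs_filter.
  exact: (cvg_norm (cvgB (Ck_scalar_continuous (Cf i 0%N) (x := x)) (cvg_cst (f 0 0 i)))).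
exists (fun x => \row_j [:: a + 4 * h x; 1 + h x * (1 - 7 * t x)]`_j); split.
  have cc c x : (c * h y @[y --> x] --> c * h x)%classic.
    exact: (cvgM (cvg_cst c) (ch x)).
  have c0 : continuous (fun x => a + 4 * h x).
    by move=> x; exact: (cvgD (cvg_cst a) (cc 4 x)).
  have c1 : continuous (fun x => 1 + h x * (1 - 7 * t x)).
    suff ct : continuous (fun x => h x * (1 - 7 * t x)).
      by move=> x; exact: (cvgD (cvg_cst (1 : R)) (ct x)).
    move=> x; have [->|x0] := eqVneq x 0; last first.
      have ct : (7 * t y @[y --> x] --> 7 * t x)%classic.
        exact: (cvgM (cvg_cst (7 : R)) (cos2_continuous (i := i1) x0)).
      exact: (cvgM (ch x) (cvgB (cvg_cst (1 : R)) ct)).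
    (* At the origin [t] has no limit to rely on, but it stays in [[0, 1]], so the product is
       squeezed between [- 7 * h] and [7 * h]. *)
    rewrite /continuous_at h0 mul0r.
    have := cc 7 0; have := cc (- 7) 0; rewrite h0 !mulr0 => cN cP.
    apply: squeeze_cvgr cN cP.
    near=> y; have := cos2_ge0 i1 y; have := cos2_le1 i1 y; rewrite -/(t y).
    by have := hpos y; nra.
  case=> [[|[|//]] jlt] /=.
    by rewrite (_ : (fun x => _) = fun x => a + 4 * h x) //; apply/funext => x; rewrite mxE.
  by rewrite (_ : (fun x => _) = fun x => 1 + h x * (1 - 7 * t x)) //; apply/funext => x; rewrite mxE.
move=> x; apply/parabola_systemP; rewrite !mxE /= -/(t x).
have := cos2_ge0 i1 x; have := cos2_le1 i1 x; rewrite -/(t x) => t1 t0.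
have hx := hpos x.
split.
- apply: le_trans (h_ge 0 x); rewrite f0 mxE /=.
  (* Along [(4, 1 - 7 t)] the first row decreases at speed [2 + 6 t + t ^ 2 - 7 t ^ 3], and this is
     the excess over 1. At [(a, 1)] the row is [(a - t) ^ 2] below its bound. *)
  have : 0 <= 1 + 6 * (t x * (1 - t x ^+ 2)) + t x ^+ 2 * (1 - t x).
    have : 0 <= t x * (1 - t x ^+ 2).
      by apply: mulr_ge0 => //; rewrite subr_ge0 expr_le1.
    have : 0 <= t x ^+ 2 * (1 - t x) by rewrite mulr_ge0 ?sqr_ge0 ?subr_ge0.
    lra.
  by move=> /(mulr_ge0 hx); have := sqr_ge0 (a - t x); lra.
- apply: le_trans (h_ge 1 x); rewrite f0 mxE /=; lra.
- apply: le_trans (h_ge 2 x); rewrite f0 mxE /=.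
  have := mulr_ge0 hx (sqr_ge0 (t x)).
  (* At [(a, 1)] the last row equals [- 1 - t (2 a - 1)], whence the condition [1 / 2 <= a]. *)
  have : 0 <= t x * (2 * a - 1) by apply: mulr_ge0 => //; lra.
  lra.
Unshelve. all: by end_near. Qed.

(** Approaching the origin in a direction with [cos2 = a] yields, by continuity, the first row for
    [F 0] with [t = a]. Its coefficients are nonnegative, so the lower bounds on [F 0] from the rows
    at the origin, where [t = 0], can be inserted. *)
Lemma parabola_necessary i2 f a : i1 != i2 -> 1 / 2 <= a <= 1 -> Cinfty f ->
  solvable_ineqs 0 parabola_system f ->
  (a *+ 2 - 1) * - f 0 0 1 + (2 - a ^+ 2) * - f 0 0 2 <= f 0 0 0.
Proof.
move=> i12 /andP[a12 a1] /CinftyP Cf [F [CF HF]].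
have {}HF x := (parabola_systemP x (F x) (f x)).1 (HF x).
have [_ F01] := HF 0; rewrite cos20 => F02.
have [|v va] := @cos2_surj R n i1 i2 a i12; first by apply/andP; split; lra.
pose G x := (a *+ 2 - 1) * F x 0 0 + (2 - a ^+ 2) * F x 0 1 - f x 0 0.
suff G0 : G 0 <= 0.
  have a2 : 0 <= 2 - a ^+ 2 by nra.
  have : 0 <= (a *+ 2 - 1) * (F 0 0 0 + f 0 0 1) by apply: mulr_ge0; lra.
  have : 0 <= (2 - a ^+ 2) * (F 0 0 1 + f 0 0 2) by apply: mulr_ge0; lra.
  by move: G0; rewrite /G; lra.
have cG : (G (e *: v) @[e --> (0 : R)^'+] --> G 0)%classic.
  apply: cvg_at_right_filter.
  have cv : (e *: v @[e --> (0 : R)] --> (0 : 'rV[R]_n))%classic.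
    by rewrite -(scale0r v); apply: scalel_continuous.
  have cGx : (G y @[y --> (0 : 'rV[R]_n)] --> G 0)%classic.
    have cF c j : (c * F y 0 j @[y --> (0 : 'rV[R]_n)] --> c * F 0 0 j)%classic.
      exact: (cvgM (cvg_cst c) (CF j 0)).
    exact: (cvgB (cvgD (cF _ _) (cF _ _)) (Ck_scalar_continuous (Cf 0 0%N) (x := 0))).
  exact: (cvg_comp _ _ cv cGx).
apply: (cvgr_to_le cG); near=> e.
have e0 : e != 0 by apply: lt0r_neq0; near: e; exact: nbhs_right_gt.
by have [] := HF (e *: v); rewrite cos2Z // va /G; lra.
Unshelve. all: by end_near. Qed.

End ParabolaSystem.

Theorem mainTheorem1 (R : realType) (n : nat) (hn : (2 <= n)%N) :
  let m := 0%N in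
  let M := 2%N in
  exists (N : nat) (A : 'rV[R]_n -> 'M[R]_(N, M)),
    (0 < N)%N /\
    (forall (i : 'I_N) (j : 'I_M), semialgebraic_fun (fun x => A x i j)) /\
    ~ (exists (mumax : nat) (mbar : nat) (nu nu' : 'I_mumax -> nat)
         (L : forall mu : 'I_mumax, 'I_(nu mu) -> diffop_coef R n N mbar)
         (L' : forall mu : 'I_mumax, 'I_(nu' mu) -> diffop_coef R n N mbar),
         (1 <= mumax)%N /\ (m <= mbar)%N /\
         (forall mu k, semialgebraic_diffop (L mu k)) /\
         (forall mu k, semialgebraic_diffop (L' mu k)) /\
         (forall f : 'rV[R]_n -> 'rV[R]_N, Cinfty f ->
            (solvable_ineqs m A f <->
             exists mu : 'I_mumax,
               (forall k x, 0 <= diffop (L mu k) f x) /\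
               (forall k x, 0 < diffop (L' mu k) f x)))).
Proof.
move=> m M; pose i1 := Ordinal (ltnW hn); pose i2 := Ordinal hn.
have i12 : i1 != i2 by [].
exists 3%N, (@parabola_system R n i1); split=> //; split=> [i j|].
  rewrite (_ : (fun x => _) = fun x => (parabola_row R i j).[cos2 i1 x]).
    exact: semialgebraic_poly_cos2.
  by apply/funext => x; rewrite mxE.
case=> [mumax [mbar [nu [nu' [L [L' [_ [_ [_ [_ H]]]]]]]]]].
pose J mu : finType := ('I_(nu mu) + 'I_(nu' mu))%type.
pose op mu (c : J mu) : diffop_coef R n 3 mbar :=
  match c with inl k => L mu k | inr k => L' mu k end.
pose strict mu (c : J mu) := if c is inr _ then true else false.
have satP f : (exists mu, satisfies op strict mu f) <->
    exists mu, (forall k x, 0 <= diffop (L mu k) f x) /\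
               (forall k x, 0 < diffop (L' mu k) f x).
  split=> [] [mu Hmu]; exists mu.
    by split=> k x; [have := Hmu (inl k) x|have := Hmu (inr k) x].
  by case: Hmu => HL HL' [k|k] x /=.
pose a (k : nat) : R := 1 - (k.+2%:R)^-1.
have a12 k : 1 / 2 <= a k <= 1.
  have : (k.+2%:R : R)^-1 <= 2^-1 by rewrite lef_pV2 ?posrE // ler_nat.
  have : 0 <= (k.+2%:R : R)^-1 by rewrite invr_ge0.
  by rewrite /a; move: (k.+2%:R^-1) => b b0 b2; apply/andP; split; lra.
have a_inj : injective a.
  by move=> k l /addrI /oppr_inj /invr_inj /eqP; rewrite eqr_nat => /eqP [].
pose p k : 'rV[R]_n -> 'rV[R]_3 := fun=> parabola_point (a k).
have Cp k : Cinfty (p k).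
  by apply/CinftyP => i; exact: smooth_cst.
have [g Cg g0 k|g [k [l [e [Cg g0 kl e0]]]]] :=
  @union_of_constraints_extends R n 3 mbar _ J op strict p Cp.
  (* Since [g 0 = 0], the perturbed datum keeps its value on the parabola and stays solvable. *)
  have Cq : Cinfty (fun x => p k x + 1 *: g x) by exact: Cinfty_lin.
  apply/satP/H => //; apply: (@parabola_solvable _ _ _ _ (a k)) => //.
    by have /andP[] := a12 k.
  by rewrite g0 scaler0 addr0.
pose f x := p k x + 1 *: g x + e *: (p k x + 1 *: g x + (-1) *: (p l x + 1 *: g x)).
move=> /satP /(H f) sat.
have Cq j : Cinfty (fun x => p j x + 1 *: g x) by exact: Cinfty_lin.
have Cf : Cinfty f by apply: Cinfty_lin => //; exact: Cinfty_lin.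
have := parabola_necessary i12 (a12 k) Cf (sat Cf).
rewrite /f g0 /p !mxE /= => ineq.
(* The necessary inequality for [a k] is an equality at [parabola_point (a k)] and has slack
   [(a k - a l) ^+ 2] at [parabola_point (a l)]; beyond the former it fails by [e] times that
   slack. *)
have : 0 < e * (a k - a l) ^+ 2.
  by rewrite mulr_gt0 // exprn_even_gt0 // subr_eq0; apply/eqP => /a_inj.
nra.
Qed.
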